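(* Let $G$ be a connected non-bipartite simple graph and let $k\ge4$ be even. Then $\rho^{\mathcal{L}}(G^{k,\frac{k}{2}})=\rho^{\mathcal{Q}}(G^{k,\frac{k}{2}})$ if and only if $k$ is a multiple of $4$. In this case, $\lambda_{\max}^{\mathcal{L}}(G^{k,\frac{k}{2}})<\rho^{\mathcal{L}}(G^{k,\frac{k}{2}})$.
   Context: Tensors: for a real order-$k$, dimension-$n$ tensor $\mathcal{T}$ and $x\in\mathbb{C}^n$, $(\mathcal{T}x^{k-1})_i=\sum_{i_2,\dots,i_k}t_{ii_2\dots i_k}x_{i_2}\cdots x_{i_k}$; $\lambda\in\mathbb{C}$ is an eigenvalue with eigenvector $x\ne0$ if $\mathcal{T}x^{k-1}=\lambda x^{[k-1]}$, $x^{[k-1]}=(x_i^{k-1})_i$; an eigenvalue with a real eigenvector is an $H$-eigenvalue. For a hypergraph $H$, $\lambda_{\max}^{\mathcal{L}}(H)$ is the largest $H$-eigenvalue of $\mathcal{L}(H)$, and $\rho^{\mathcal{L}}(H),\rho^{\mathcal{Q}}(H)$ are the spectral radii (maximum modulus of eigenvalues) of $\mathcal{L}(H),\mathcal{Q}(H)$. Hypergraphs: degree $d_v$ = number of edges containing $v$. For a $k$-uniform hypergraph on $v_1,\dots,v_n$, $\mathcal{A}$ has $a_{i_1\dots i_k}=\frac{1}{(k-1)!}$ if $\{v_{i_1},\dots,v_{i_k}\}$ is an edge, else $0$; $\mathcal{D}$ diagonal with $d_{i\dots i}=d_{v_i}$; $\mathcal{L}=\mathcal{D}-\mathcal{A}$,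 $\mathcal{Q}=\mathcal{D}+\mathcal{A}$. Generalized power $G^{k,\frac{k}{2}}$ ($k\ge4$ even): replace each vertex $v$ of $G$ by a set $\mathbf{v}$ of $\frac{k}{2}$ vertices containing $v$ (pairwise disjoint), and for each edge $\{u,v\}$ of $G$ take $\mathbf{u}\cup\mathbf{v}$ as an edge. *)

(* Defs.v *)
From HB Require Import structures.
From mathcomp Require Import all_boot all_order all_algebra.
From mathcomp Require Import complex.
From mathcomp Require Import boolp classical_sets reals.

Set Implicit Arguments.
Unset Strict Implicit.
Unset Printing Implicit Defensive.

Import Order.TTheory GRing.Theory Num.Theory.
Local Open Scope ring_scope.
Local Open Scope complex_scope.

(* The largest element of A, with default value 0 when A has none. A tensor of
   order >= 2 and nonzero dimension has finitely many eigenvalues and at least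
   one; a symmetric real tensor of even order has an H-eigenvalue. *)
Definition set_maximum (R : realType) (A : set R) : R :=
  xget 0 [set m | A m /\ ubound A m]%classic.

Lemma set_maximumE (R : realType) (A : set R) (m : R) :
  A m -> ubound A m -> set_maximum A = m.
Proof.
move=> Am ubm; apply: xget_unique => [//|y [Ay uby]].
by apply/eqP; rewrite eq_le; apply/andP; split; [exact: ubm | exact: uby].
Qed.

(* Real tensors of order k and dimension #|I|; the dimension is given by an
   index set I instead of {1, ..., n}. *)
Definition tensor (R : realType) (I : finType) (k : nat) := k.-tuple I -> R.

(* The vector T x^{k-1}: its entry at i sums over the index tuples
   (i, i_2, ..., i_k), and behead drops the fixed first index. *)
Definition tensor_app (R : realType) (I : finType) (k : nat)
    (T : tensor R I k) (x : {ffun I -> R[i]}) : {ffun I -> R[i]} :=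
  [ffun i => \sum_(t : k.-tuple I | ohead t == Some i)
               (T t)%:C * \prod_(j <- behead t) x j].

Definition eigenpair (R : realType) (I : finType) (k : nat)
    (T : tensor R I k) (l : R[i]) (x : {ffun I -> R[i]}) : Prop :=
  x != 0 /\ tensor_app T x = [ffun i => l * x i ^+ k.-1].

Definition tensor_eigenvalue (R : realType) (I : finType) (k : nat)
    (T : tensor R I k) (l : R[i]) : Prop :=
  exists x, eigenpair T l x.

Definition H_eigenvalue (R : realType) (I : finType) (k : nat)
    (T : tensor R I k) (l : R[i]) : Prop :=
  exists x, eigenpair T l x /\ forall i, x i \is Num.real.

Definition spectral_radius (R : realType) (I : finType) (k : nat)
    (T : tensor R I k) : R :=
  set_maximum [set r : R | exists l : R[i], tensor_eigenvalue T l /\ `|l| = r%:C]%classic.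

(* H-eigenvalues of a real tensor are real, so none is lost by ranging over R. *)
Definition lambda_max (R : realType) (I : finType) (k : nat)
    (T : tensor R I k) : R :=
  set_maximum [set r : R | H_eigenvalue T r%:C]%classic.

(* A hypergraph on the vertex set V, given by its edges. *)
Definition hypergraph (V : finType) := {set {set V}}.

Definition uniform_hypergraph (V : finType) (k : nat) (H : hypergraph V) : Prop :=
  forall e, e \in H -> #|e| = k.

Definition degree (V : finType) (H : hypergraph V) (v : V) : nat :=
  #|[set e in H | v \in e]|.

(* The order k of the tensors below is meant to be the uniformity of H. *)
Definition adjacency (R : realType) (V : finType) (k : nat)
    (H : hypergraph V) : tensor R V k :=
  fun t => if [set v in t] \in H then ((k.-1)`!%:R)^-1 else 0.

Definition degree_tensor (R : realType) (V : finType) (k : nat)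
    (H : hypergraph V) : tensor R V k :=
  fun t => \sum_(v : V | t == [tuple of nseq k v]) (degree H v)%:R.

Definition laplacian (R : realType) (V : finType) (k : nat)
    (H : hypergraph V) : tensor R V k :=
  fun t => degree_tensor R H t - adjacency R H t.

Definition signless_laplacian (R : realType) (V : finType) (k : nat)
    (H : hypergraph V) : tensor R V k :=
  fun t => degree_tensor R H t + adjacency R H t.

Arguments laplacian R {V} k H _ : simpl never.
Arguments signless_laplacian R {V} k H _ : simpl never.

(* Simple graphs on V are symmetric irreflexive relations. *)
Definition graph_connected (V : finType) (G : rel V) : Prop :=
  forall u v, connect G u v.

Definition graph_bipartite (V : finType) (G : rel V) : Prop :=
  exists c : V -> bool, forall u v, G u v -> c u != c v.

(* The set of k/2 vertices replacing v; (v, 0) plays the role of v itself. *)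
Definition blowup (V : finType) (k : nat) (v : V) : {set V * 'I_(k./2)} :=
  [set p | p.1 == v].

Definition gpower (V : finType) (k : nat) (G : rel V) :
    hypergraph (V * 'I_(k./2))%type :=
  [set blowup k uv.1 :|: blowup k uv.2 | uv in [set uv : V * V | G uv.1 uv.2]].

Lemma card_blowup (V : finType) (k : nat) (v : V) : #|blowup k v| = k./2.
Proof.
have -> : blowup k v = finset.setX [set v] [set: 'I_(k./2)].
  by apply/setP=> p; rewrite !inE andbT.
by rewrite cardsX cards1 cardsT card_ord mul1n.
Qed.

Lemma gpower_uniform (V : finType) (k : nat) (G : rel V) :
  irreflexive G -> ~~ odd k -> uniform_hypergraph k (gpower k G).
Proof.
move=> irrG evk _ /imsetP[[u v] /[!inE]/= Guv ->].
have uv : u != v by apply: contraTneq Guv => ->; rewrite irrG.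
rewrite cardsU !card_blowup.
have -> : blowup k u :&: blowup k v = finset.set0.
  apply/setP=> p; rewrite !inE; apply/negP=> /andP[/eqP-> /eqP uv'].
  by rewrite uv' eqxx in uv.
by rewrite cards0 subn0 addnn halfK (negbTE evk) subn0.
Qed.

(* Main.v *)
Require Import Defs.
From mathcomp Require Import all_boot all_order all_algebra.
From mathcomp Require Import reals.
From mathcomp Require Import complex ring.
From mathcomp Require boolp classical_sets topology normedtype derive.

(* Write m = k/2 and, for a vector x on the vertices of G^{k,k/2}, let y_v be
   the product of the entries of x over the block of v. Multiplying the
   eigenvalue equation of D + e A (e = 1 or -1) at the vertex (v, a) by its own
   entry turns it into
     (l - d_v) x_{v,a}^k = e y_v (sum of y_u over the neighbours u of v),
   so the norm of x_{v,a}^k is |y_v|^2 whenever l <> d_v.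
   Let q be the Perron eigenvalue of the signless Laplacian matrix of G, with
   positive eigenvector z. Pairing |y| with z gives |l| <= q. The bound is
   attained for e = 1 by x_{v,a} = z_v^{1/m}, and for e = -1 when 4 | k by
   multiplying one entry of each block by the imaginary unit.
   Conversely, if e = -1 and |l| = q, all inequalities are equalities: y has no
   zero entry and x_{v,a}^k |y_u| = - y_v y_u |y_v| on every edge uv. Taking the
   product over a block shows that (y / |y|)^m changes sign along every edge if
   m is odd, and if x is real, y itself changes sign along every edge. Both are
   impossible for a non-bipartite graph. *)

Import Order.TTheory GRing.Theory Num.Theory.
Set Implicit Arguments.
Unset Strict Implicit.
Unset Printing Implicit Defensive.

Local Open Scope ring_scope.
Local Open Scope complex_scope.

(** * Neighbour sums and propagation along a connected graph *)

Definition graph_degree (V : finType) (G : rel V) (v : V) : nat :=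
  #|[pred u | G v u]|.

Definition nbr_sum (F : numDomainType) (V : finType) (G : rel V) (y : V -> F)
  (v : V) : F := \sum_(u | G v u) y u.

Lemma nbr_sum_sym (F : numDomainType) (V : finType) (G : rel V) (x y : V -> F) :
  symmetric G -> \sum_v x v * nbr_sum G y v = \sum_v y v * nbr_sum G x v.
Proof.
move=> symG; under eq_bigr do rewrite /nbr_sum mulr_sumr.
rewrite (exchange_big_dep predT) //=; apply: eq_bigr => u _.
rewrite mulr_sumr; under eq_bigl do rewrite symG.
by apply: eq_bigr => v _; rewrite mulrC.
Qed.

Lemma connected_closed (V : finType) (G : rel V) (P : pred V) (u : V) :
  symmetric G -> graph_connected G -> (forall v w, G v w -> P v -> P w) ->
  P u -> forall v, P v.
Proof.
move=> symG connG Pcl Pu v.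
have cl : closed G P.
  apply: intro_closed => [|a b Gab Pa]; last exact: Pcl Gab Pa.
  exact: symmetric_from_pre.
by have := closed_connect cl (connG u v); rewrite -!topredE /= Pu.
Qed.

(** * Comparison of subsolutions with a positive eigenvector *)

Section MaximumPrinciple.
Variables (F : numDomainType) (V : finType) (G : rel V).
Hypotheses (symG : symmetric G) (connG : graph_connected G).

(** At a zero of [w] the nonnegative neighbour values sum to zero, so all of them vanish; by
    connectedness a single zero would spread to the whole graph. *)
Lemma nbr_sum_eigen_gt0 (t : V -> F) (w : V -> F) (v0 : V) :
  (forall v, 0 <= w v) -> (forall v, t v * w v = nbr_sum G w v) ->
  w v0 != 0 -> forall v, 0 < w v.
Proof.
move=> w_ge0 wE wv0 v; rewrite lt_neqAle w_ge0 andbT eq_sym.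
move: v0 wv0 v; suff wz u : w u == 0 -> forall v, w v == 0.
  by move=> v0 wv0 v; apply: contra wv0 => /wz.
apply: (connected_closed (P := [pred v | w v == 0])) => //= a b Gab /eqP wa.
have /eqP := wE a; rewrite wa mulr0 eq_sym => /eqP /psumr_eq0P wb.
by rewrite wb.
Qed.

Variables (q : F) (z : V -> F).
Hypotheses (z_gt0 : forall v, 0 < z v)
  (zE : forall v, (q - (graph_degree G v)%:R) * z v = nbr_sum G z v).

Lemma degree_le_perron v : (graph_degree G v)%:R <= q.
Proof.
rewrite -subr_ge0 -(pmulr_lge0 _ (z_gt0 v)) zE.
by apply: sumr_ge0 => u _; apply: ltW.
Qed.

Lemma nbr_sum_weighted (w : V -> F) :
  \sum_v z v * nbr_sum G w v =
  \sum_v z v * ((q - (graph_degree G v)%:R) * w v).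
Proof.
by rewrite nbr_sum_sym //; apply: eq_bigr => v _; rewrite -zE; ring.
Qed.

(** Pairing the slack of the inequality with [z] gives [q - t] times the positive sum of the
    [z v * w v], because the adjacency operator is self-adjoint. *)
Lemma subsolution_le (t : F) (w : V -> F) (v0 : V) :
  (forall v, 0 <= w v) -> w v0 != 0 ->
  (forall v, (t - (graph_degree G v)%:R) * w v <= nbr_sum G w v) ->
  t <= q.
Proof.
move=> w_ge0 wv0 wsub.
have S_gt0 : 0 < \sum_v z v * w v.
  rewrite (bigD1 v0) //=; apply: ltr_pwDl.
    by rewrite mulr_gt0 // lt0r wv0 w_ge0.
  by apply: sumr_ge0 => v _; rewrite mulr_ge0 // ltW.
have diffE : q * (\sum_v z v * w v) - t * (\sum_v z v * w v) =
    \sum_v z v * (nbr_sum G w v - (t - (graph_degree G v)%:R) * w v).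
  under [RHS]eq_bigr do rewrite mulrBr.
  rewrite sumrB nbr_sum_weighted -sumrB !mulr_sumr -sumrB.
  by apply: eq_bigr => v _; ring.
rewrite -(ler_pM2r S_gt0) -subr_ge0 diffE; apply: sumr_ge0 => v _.
by rewrite mulr_ge0 ?subr_ge0 // ltW.
Qed.

(** For [t = q] the slack pairs with [z] to zero; its terms are nonnegative and the weights
    positive, so each slack vanishes. *)
Lemma subsolution_eq (w : V -> F) :
  (forall v, (q - (graph_degree G v)%:R) * w v <= nbr_sum G w v) ->
  forall v, (q - (graph_degree G v)%:R) * w v = nbr_sum G w v.
Proof.
move=> wsub v; apply/esym/eqP; rewrite -subr_eq0.
have: \sum_v z v *
    (nbr_sum G w v - (q - (graph_degree G v)%:R) * w v) = 0.
  by under eq_bigr do rewrite mulrBr; rewrite sumrB nbr_sum_weighted subrr.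
move/psumr_eq0P => /(_ _ v isT) /eqP; rewrite mulf_eq0 gt_eqF //=; apply.
by move=> u _; rewrite mulr_ge0 ?subr_ge0 // ltW.
Qed.

End MaximumPrinciple.

(** * Existence of the Perron vector by maximising a quadratic form *)

Section Perron.
Variables (R : realType) (V : finType) (G : rel V).
Hypotheses (symG : symmetric G) (connG : graph_connected G).

(** [Q] is the quadratic form of the signless Laplacian matrix of [G], and [N] the squared Euclidean
    norm. *)
Let Q (x : V -> R) :=
  \sum_v x v * ((graph_degree G v)%:R * x v + nbr_sum G x v).
Let N (x : V -> R) := \sum_v x v ^+ 2.

Let N_gt0 (x : V -> R) v0 : x v0 != 0 -> 0 < N x.
Proof.
move=> xv0; rewrite /N (bigD1 v0) //=; apply: ltr_pwDl.
  by rewrite exprn_even_gt0.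
by apply: sumr_ge0 => v _; apply: sqr_ge0.
Qed.

Let Q_scale t x : Q (fun v => t * x v) = t ^+ 2 * Q x.
Proof.
rewrite /Q mulr_sumr; apply: eq_bigr => v _.
by rewrite /nbr_sum -mulr_sumr; ring.
Qed.

Let N_scale t x : N (fun v => t * x v) = t ^+ 2 * N x.
Proof. by rewrite /N mulr_sumr; apply: eq_bigr => v _; rewrite exprMn. Qed.

Import boolp classical_sets topology normedtype derive.
Import ArrowAsProduct.
Import numFieldNormedType.Exports.

(** The unit sphere is closed in the cube of side [[-1, 1]], which is compact by Tychonoff, and [Q]
    is continuous. *)
Let sphere_max (v0 : V) :
  exists2 z : V -> R, N z = 1 & forall x, N x = 1 -> Q x <= Q z.
Proof.
have projc (v : V) : continuous (fun x : V -> R => x v).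
  exact: (@proj_continuous V (fun _ : V => R) v).
have sumc (P : pred V) (f : V -> (V -> R) -> R) :
    (forall v, continuous (f v)) ->
    continuous (fun x : V -> R => \sum_(v | P v) f v x).
  by move=> fc; apply: continuous_big => [|//]; exact: add_continuous.
have mulc (f g : (V -> R) -> R) : continuous f -> continuous g ->
    continuous (fun x : V -> R => f x * g x).
  by move=> fc gc x; apply: continuousM; [exact: fc | exact: gc].
have addc (f g : (V -> R) -> R) : continuous f -> continuous g ->
    continuous (fun x : V -> R => f x + g x).
  by move=> fc gc x; apply: (@continuousD R R); [exact: fc | exact: gc].
have Qc : continuous Q.
  apply: (sumc predT) => v; apply: (mulc (fun x => x v)) => //.
  apply: (addc (fun x => _)); last exact: (sumc (G v) (fun u x => x u)).
  by apply: mulc => // x; exact: cst_continuous.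
have Nc : continuous N.
  by apply: (sumc predT) => v; apply: (mulc (fun x => x v) (fun x => x v)).
have Ksub : ([set x : V -> R | N x = 1] `<=`
    [set x : V -> R | forall v, `[-1, 1]%classic (x v)])%classic.
  move=> x /= Nx v; rewrite in_itv /= -ler_norml -(expr_le1 (n := 2)) //.
  rewrite real_normK ?num_real // -Nx /N (bigD1 v) //= lerDl.
  by apply: sumr_ge0 => u _; apply: sqr_ge0.
have Kc : compact [set x : V -> R | N x = 1]%classic.
  apply: (subclosed_compact _ _ Ksub).
    by apply: (preimage_closed (f := N) (D := [set 1%R]%classic)) => // x _;
       exact: Nc.
  apply: (@tychonoff V (fun _ => R) (fun _ => `[-1, 1]%classic)) => _.
  exact: segment_compact.
have [||z] := compact_EVT_max (f := Q) _ Kc.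
- exists (fun v => (v == v0)%:R) => /=.
  rewrite /N (bigD1 v0) //= eqxx expr1n big1 ?addr0 // => v /negbTE ->.
  by rewrite expr0n.
- exact: continuous_subspaceT.
- rewrite inE /= => Nz zmax; exists z => // x Nx.
  by apply: zmax; rewrite inE.
Qed.

(** Taking absolute values of a maximiser on the sphere does not lower [Q]. The resulting
    nonnegative maximiser is an eigenvector, hence positive since zeros would spread. *)
Lemma perron_vector (v0 : V) : exists (q : R) (z : V -> R),
  (forall v, 0 < z v) /\
  (forall v, (q - (graph_degree G v)%:R) * z v = nbr_sum G z v).
Proof.
have [z0 Nz0 z0max] := sphere_max v0.
pose q := Q z0.
(* Homogeneity of degree two carries the bound from the sphere to every vector; the zero vector is
   treated apart. *)
have Qle x : Q x <= q * N x.
  have [[v xv]|x0] := boolp.pselect (exists v, x v != 0); last first.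
    have {}x0 v : x v = 0 by apply/eqP/negPn/negP => xv; apply: x0; exists v.
    rewrite /Q /N !big1 ?mulr0 // => v _; rewrite x0 ?expr0n ?mul0r //.
  have Nx := N_gt0 xv.
  have s_gt0 : 0 < Num.sqrt (N x) by rewrite sqrtr_gt0.
  have sK : Num.sqrt (N x) ^+ 2 = N x by rewrite sqr_sqrtr // ltW.
  have := z0max (fun v => (Num.sqrt (N x))^-1 * x v).
  rewrite N_scale Q_scale exprVn sK mulVf ?gt_eqF // => /(_ erefl).
  by rewrite mulrC ler_pdivrMr.
pose z v := `|z0 v|.
have Nz : N z = 1.
  by rewrite -Nz0; apply: eq_bigr => v _; rewrite real_normK ?num_real.
have Qz : Q z = q.
  apply: le_anti; rewrite (le_trans (Qle z)) ?Nz ?mulr1 //=.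
  apply: ler_sum => v _; apply: (le_trans (ler_norm _)).
  rewrite normrM ler_wpM2l //.
  apply: (le_trans (ler_normD _ _)); rewrite normrM normr_nat lerD2l.
  exact: ler_norm_sum.
(* The residual of the eigenvalue equation is half the gradient of [q N - Q] at [z], so it serves as
   the direction of variation. *)
pose r v := (q - (graph_degree G v)%:R) * z v - nbr_sum G z v.
have expand t : q * N (fun v => z v + t * r v) - Q (fun v => z v + t * r v) =
    2 * t * N r + t ^+ 2 * (q * N r - Q r).
  have cross : \sum_v z v * nbr_sum G r v = \sum_v r v * nbr_sum G z v.
    exact: nbr_sum_sym.
  have nbrD v : nbr_sum G (fun v => z v + t * r v) v =
      nbr_sum G z v + t * nbr_sum G r v.
    by rewrite /nbr_sum mulr_sumr -big_split.
  have zero : q * N z - Q z = 0 by rewrite Nz Qz mulr1 subrr.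
  (* Two vanishing terms are added so that both sides agree summand by summand. *)
  have -> : 2 * t * N r = 2 * t * N r + (q * N z - Q z) +
      t * (\sum_v r v * nbr_sum G z v - \sum_v z v * nbr_sum G r v).
    by rewrite zero cross; ring.
  rewrite /N /Q !mulr_sumr -!sumrB !mulr_sumr -!big_split /=.
  by apply: eq_bigr => v _; rewrite nbrD /r; ring.
(* Since q N - Q >= 0 vanishes at z, its first variation at z vanishes too; the
   step along r below would make it negative if N r > 0. *)
have r0 : N r = 0.
  set c := q * N r - Q r in expand.
  have ge0 t : 0 <= 2 * t * N r + t ^+ 2 * c by rewrite -expand subr_ge0.
  have c_ge0 : 0 <= c by rewrite subr_ge0.
  have Nr : 0 <= N r by apply: sumr_ge0 => v _; apply: sqr_ge0.
  apply/eqP; rewrite eq_le Nr andbT leNgt; apply/negP => N_r.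
  have c1 : 0 < c + N r by rewrite ltr_wpDl.
  (* The denominator is positive even if [c = 0], and at this [t] the expression equals
     [- t ^+ 2 * (c + 2 * N r)]. *)
  have := ge0 (- N r / (c + N r)).
  rewrite leNgt => /negP; apply.
  have -> : 2 * (- N r / (c + N r)) * N r + (- N r / (c + N r)) ^+ 2 * c =
      - (N r / (c + N r)) ^+ 2 * (c + 2 * N r) by field; rewrite gt_eqF.
  by rewrite nmulr_rlt0 ?oppr_lt0 ?exprn_gt0 ?divr_gt0 // ltr_wpDl ?mulr_gt0.
have zE v : (q - (graph_degree G v)%:R) * z v = nbr_sum G z v.
  apply/eqP; rewrite -subr_eq0 -[_ - _]/(r v) -sqrf_eq0.
  by move: r0 => /psumr_eq0P -> // u _; apply: sqr_ge0.
have [v zv] : exists v, z v != 0.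
  apply: boolp.contrapT => z_0; have := oner_neq0 R; rewrite -Nz /N.
  rewrite big1 ?eqxx // => v _.
  by apply/eqP; rewrite sqrf_eq0; apply/negPn/negP => zv; apply: z_0; exists v.
exists q, z; split=> //.
apply: (nbr_sum_eigen_gt0 symG connG _ zE zv) => u; exact: normr_ge0.
Qed.

End Perron.

(** * The equation for block products: bound on the eigenvalues *)

Section PowerEquation.
Variables (C : numClosedFieldType) (V : finType) (G : rel V).
Hypotheses (symG : symmetric G) (connG : graph_connected G).
Variables (q : C) (z : V -> C).
Hypotheses (z_gt0 : forall v, 0 < z v)
  (zE : forall v, (q - (graph_degree G v)%:R) * z v = nbr_sum G z v).
Variables (m : nat) (m_gt0 : (0 < m)%N) (x : V -> 'I_m -> C).
Let y v := \prod_a x v a.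
Variables (l s : C) (norm_s : `|s| = 1).
Hypothesis xE : forall v a, (l - (graph_degree G v)%:R) * x v a ^+ m.*2 =
  s * (y v * nbr_sum G y v).
Variables (v0 : V) (a0 : 'I_m).
Hypothesis x_neq0 : x v0 a0 != 0.

Let w v := `|y v|.

(** The right-hand side of [xE] does not depend on the position in the block, so all entries of the
    block have the same modulus. *)
Lemma block_norm v a : l != (graph_degree G v)%:R ->
  `|x v a| ^+ m = w v.
Proof.
rewrite -subr_eq0 => ld.
rewrite /w /y normr_prod -[in LHS](card_ord m) -prodr_const.
apply: eq_bigr => b _.
have eqk : x v a ^+ m.*2 = x v b ^+ m.*2 by apply: (mulfI ld); rewrite !xE.
apply: (@pexpIrn _ m.*2); rewrite ?nnegrE ?double_gt0 //.
by rewrite -!normrX eqk.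
Qed.

(** Norms in [xE] give the first alternative multiplied by [w v], a factor that cancels unless it is
    zero. *)
Lemma block_le v : l != (graph_degree G v)%:R ->
  `|l - (graph_degree G v)%:R| * w v = `|nbr_sum G y v| \/ w v = 0.
Proof.
move=> ld; have [->|wv] := eqVneq (w v) 0; [by right | left].
apply: (mulIf wv); have /(congr1 Num.norm) := xE v a0.
rewrite !normrM norm_s mul1r normrX -addnn exprD block_norm // mulrA.
by rewrite [RHS]mulrC.
Qed.

(** The triangle inequality is used twice: on [l] minus the degree, and on the neighbour sum of
    [y]. *)
Lemma block_sub v : l != (graph_degree G v)%:R ->
  (`|l| - (graph_degree G v)%:R) * w v <= nbr_sum G w v.
Proof.
move=> ld; have [E|->] := block_le ld; last first.
  by rewrite mulr0; apply: sumr_ge0 => u _; apply: normr_ge0.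
apply: (@le_trans _ _ (`|l - (graph_degree G v)%:R| * w v)).
  by rewrite ler_wpM2r ?normr_ge0 // -[X in _ - X]normr_nat lerB_dist.
by rewrite E ler_norm_sum.
Qed.

Lemma power_eigenvalue_le : `|l| <= q.
Proof.
have [v /eqP->|ld] := pickP [pred v | l == (graph_degree G v)%:R].
  by rewrite normr_nat (degree_le_perron z_gt0 zE).
apply: (subsolution_le symG z_gt0 zE (w := w) (v0 := v0)).
- by move=> v; apply: normr_ge0.
- by rewrite -(block_norm a0) ?expf_neq0 ?normr_eq0 // (negbT (ld _)).
- by move=> v; apply: block_sub; apply: (negbT (ld _)).
Qed.

(** * The equality case, in which the modulus of [l] is [q] *)

Hypotheses (deg_lt : forall v, (graph_degree G v)%:R < q)
  (deg_gt0 : forall v, (0 < graph_degree G v)%N).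
Hypotheses (norm_l : `|l| = q).

Lemma extremal_neq_degree v : l != (graph_degree G v)%:R.
Proof.
by apply: contraTneq (deg_lt v) => lE; rewrite -norm_l lE normr_nat ltxx.
Qed.

Let wE v : (q - (graph_degree G v)%:R) * w v = nbr_sum G w v.
Proof.
apply: (subsolution_eq symG z_gt0 zE) => u.
by rewrite -norm_l; apply: block_sub; exact: extremal_neq_degree.
Qed.

Lemma extremal_gt0 v : 0 < w v.
Proof.
apply: (nbr_sum_eigen_gt0 symG connG
  (t := fun v => q - (graph_degree G v)%:R) (v0 := v0)) => //.
  by move=> u; exact: normr_ge0.
by rewrite -(block_norm a0) ?extremal_neq_degree // expf_neq0 ?normr_eq0.
Qed.

(** With [d] the degree of [v0], the moduli of [l - d] and [d] add up to that of [l]. Equality in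
    the triangle inequality gives [l - d] the phase of [d > 0]. *)
Lemma extremal_real : l = q.
Proof.
have d1 : `|l - (graph_degree G v0)%:R| = q - (graph_degree G v0)%:R.
  apply: (mulIf (lt0r_neq0 (extremal_gt0 v0))).
  have [E|/eqP] := block_le (extremal_neq_degree v0); last first.
    by rewrite gt_eqF ?extremal_gt0.
  apply: le_anti; rewrite {1}E wE ler_norm_sum /= -wE ler_wpM2r ?normr_ge0 //.
  by rewrite -norm_l -[X in _ - X]normr_nat lerB_dist.
set d := (graph_degree G v0)%:R in d1.
have d_gt0 : 0 < d by rewrite ltr0n.
(* The decomposition of [l] is written as a sum over [bool] to fit [normC_sum_eq]. *)
pose P := [pred b : bool | true].
pose f (b : bool) := if b then l - d else d.
have sumf : \sum_(b | P b) f b = l by rewrite big_bool /= subrK.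
have [|t /eqP t1 ft] := @normC_sum_eq C bool P f.
  by rewrite sumf big_bool /= d1 norm_l (gtr0_norm d_gt0) subrK.
have t1' : t = 1.
  have /= := ft false isT; rewrite (gtr0_norm d_gt0) -[LHS]mulr1.
  by move/(mulfI (lt0r_neq0 d_gt0)).
have /= := ft true isT; rewrite t1' mulr1 d1.
by move/addIr.
Qed.

(** Equality in the triangle inequality for the neighbour sum makes all neighbours of [v] share one
    phase [t]; multiplying [xE] by [w u] turns [t] into [y u]. *)
Lemma extremal_edge v u a : G v u ->
  x v a ^+ m.*2 * w u = s * (y v * y u * w v).
Proof.
move=> Gvu.
have qd : q - (graph_degree G v)%:R != 0 by rewrite subr_eq0 gt_eqF.
have [|t _ yt] := @normC_sum_eq C V (G v) y.
  have [E|/eqP] := block_le (extremal_neq_degree v); last first.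
    by rewrite gt_eqF ?extremal_gt0.
  rewrite -/(nbr_sum G y v) -E extremal_real -[RHS]wE.
  by rewrite gtr0_norm ?subr_gt0.
have yS : nbr_sum G y v = (q - (graph_degree G v)%:R) * w v * t.
  by rewrite wE /nbr_sum mulr_suml; apply: eq_bigr => i /yt.
have := xE v a; rewrite extremal_real yS => E.
apply: (mulfI qd); rewrite [LHS]mulrA E (yt u Gvu) -/(w u).
by ring.
Qed.

End PowerEquation.

(** * Tensors of a uniform hypergraph applied to a vector *)

Lemma set_consE_uniq (I : finType) (n : nat) (E : {set I}) (i : I)
    (t : n.-tuple I) : #|E| = n.+1 -> i \in E ->
  ([set j in i :: t] == E) = (all [in E :\ i] t && uniq t).
Proof.
move=> cardE iE; apply/eqP/andP => [setE|[/allP tE t_uniq]].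
  have : uniq (i :: t).
    by apply/card_uniqP; rewrite /= size_tuple -cardE -setE cardsE.
  move=> /= /andP[it t_uniq]; split=> //; apply/allP => j jt.
  rewrite !inE -setE inE in_cons jt orbT andbT.
  by apply: contraNneq it => <-.
apply/eqP; rewrite eqEcard; apply/andP; split.
  by apply/subsetP => j; rewrite !inE => /predU1P[->//|/tE/[!inE]/andP[]].
rewrite cardsE cardE.
have /card_uniqP -> : uniq (i :: t).
  by rewrite /= t_uniq andbT; apply/negP => /tE; rewrite !inE eqxx.
by rewrite /= size_tuple -cardE cardE.
Qed.

(** The tails of these tuples are the orderings of [E :\ i]; there are [n]! of them and they all
    give the same product. *)
Lemma sum_edge_tuples (C : comNzRingType) (I : finType) (n : nat) (E : {set I})
    (i : I) (x : I -> C) : #|E| = n.+1 -> i \in E ->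
  \sum_(t : n.+1.-tuple I | (ohead t == Some i) && ([set j in t] == E))
     \prod_(j <- behead t) x j = n`!%:R * \prod_(j in E :\ i) x j.
Proof.
move=> cardE iE.
rewrite (reindex_onto (fun t : n.-tuple I => [tuple of i :: t])
  (fun t : n.+1.-tuple I => [tuple of behead t])); last first.
  by move=> t /andP[/eqP]; case/tupleP: t => j t /= [->] _; apply: val_inj.
rewrite (eq_bigl (fun t => t \in
    [set t : n.-tuple I | all [in E :\ i] t & uniq t])).
  rewrite [LHS](eq_bigr (fun _ => \prod_(j in E :\ i) x j)) => [|t].
    rewrite sumr_const card_uniq_tuples mulr_natl.
    have -> : #|[in E :\ i]| = n.
      by have := cardsD1 i E; rewrite iE cardE => -[].
    by rewrite ffactnn.
  rewrite inE => /andP[/allP tE t_uniq] /=.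
  rewrite big_uniq //; apply: eq_bigl => j /=.
  have cardt : #|t| = #|E :\ i|.
    rewrite (card_uniqP t_uniq) size_tuple.
    by have := cardsD1 i E; rewrite iE cardE => -[].
  suff /(subset_cardP cardt) : t \subset E :\ i by apply.
  by apply/subsetP => k /tE.
move=> t; rewrite inE -set_consE_uniq //= eqxx /=.
by rewrite [X in _ && X](_ : _ = true) ?andbT //; apply/eqP/val_inj.
Qed.

Section TensorApp.
Variables (R : realType) (I : finType) (n : nat) (H : hypergraph I).
Hypothesis unifH : uniform_hypergraph n.+1 H.
Implicit Type x : {ffun I -> R[i]}.

Lemma degree_tensor_app x i :
  tensor_app (degree_tensor R (k := n.+1) H) x i = (degree H i)%:R * x i ^+ n.
Proof.
rewrite ffunE (bigD1 [tuple of nseq n.+1 i]) //=.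
rewrite [X in _ + X]big1 => [|t /andP[ti tn]].
  rewrite addr0 big_nseq iter_mulr_1; congr (_ * _).
  rewrite /degree_tensor (big_pred1 i) => [|v /=]; first by rewrite rmorph_nat.
  by apply/eqP/eqP => [/(congr1 val)[]|->//].
rewrite /degree_tensor [X in X%:C]big_pred0 ?mul0r // => v; apply: contraNF tn.
by move=> /eqP tv; move: ti; rewrite tv => /eqP[->].
Qed.

(** Tuples are grouped by the edge they span; the number of orderings cancels the factorial in the
    entries of the tensor. *)
Lemma adjacency_app x i :
  tensor_app (adjacency R (k := n.+1) H) x i =
  \sum_(E in [set E in H | i \in E]) \prod_(j in E :\ i) x j.
Proof.
rewrite ffunE.
rewrite (bigID (fun t : n.+1.-tuple I => [set v in t] \in H)) /= addrC big1.
  rewrite add0r; under eq_bigr do rewrite /adjacency.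
  rewrite (partition_big (fun t : n.+1.-tuple I => [set v in t])
    [in [set E in H | i \in E]]) => [|t /andP[/eqP ti tH]]; last first.
    by rewrite !inE tH; case/tupleP: t ti {tH} => j t [->]; rewrite inE eqxx.
  apply: eq_bigr => E /[!inE] /andP[EH iE].
  rewrite (eq_bigl (fun t : n.+1.-tuple I =>
    (ohead t == Some i) && ([set j in t] == E))) => [|t]; last first.
    rewrite -andbA; congr (_ && _); apply: andb_idl => /eqP ->; exact: EH.
  under eq_bigr => t /andP[_ /eqP tE] do rewrite tE EH.
  rewrite -mulr_sumr sum_edge_tuples ?(unifH EH) // mulrA.
  rewrite fmorphV /= rmorph_nat mulVf ?mul1r //.
  by rewrite pnatr_eq0 -lt0n fact_gt0.
by move=> t /andP[_ /negbTE tH]; rewrite /adjacency tH mul0r.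
Qed.

Lemma signed_laplacian_app (e : R) x i :
  tensor_app (fun t : n.+1.-tuple I =>
    degree_tensor R H t + e * adjacency R H t) x i =
  (degree H i)%:R * x i ^+ n +
  e%:C * \sum_(E in [set E in H | i \in E]) \prod_(j in E :\ i) x j.
Proof.
rewrite -degree_tensor_app -adjacency_app !ffunE mulr_sumr -big_split /=.
by apply: eq_bigr => t _; rewrite rmorphD rmorphM mulrDl mulrA.
Qed.

End TensorApp.

(** * Edges, degrees and block products of the generalized power *)

Section Gpower.
Variables (V : finType) (G : rel V) (k : nat).
Hypotheses (symG : symmetric G) (irrG : irreflexive G).

Lemma gpower_edges_at v a :
  [set E in gpower k G | (v, a) \in E] =
  [set blowup k v :|: blowup k u | u in [pred u | G v u]].
Proof.
apply/setP => E; rewrite inE; apply/andP/imsetP => [[]|[u /= Gvu ->]].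
  case/imsetP => -[u w] /[!inE] /= Guw -> /[!inE] /= /orP[]/eqP vE.
    by exists w; rewrite ?inE /= vE.
  by exists u; rewrite ?inE /= vE 1?symG // setUC.
rewrite inE in Gvu; split; last by rewrite !inE eqxx.
by apply/imsetP; exists (v, u); rewrite ?inE.
Qed.

(** The index [a] witnesses that blocks are nonempty; with empty blocks all these unions would
    coincide. *)
Lemma blowup_union_inj v (a : 'I_(k./2)) :
  {in [pred u | G v u] &, injective (fun u => blowup k v :|: blowup k u)}.
Proof.
move=> u u' /[!inE] Gvu _ /setP/(_ (u, a)).
rewrite !inE /= eqxx orbT => /esym/orP[]/eqP // uv.
by rewrite uv irrG in Gvu.
Qed.

Lemma gpower_degree v a : degree (gpower k G) (v, a) = graph_degree G v.
Proof.
rewrite /degree gpower_edges_at card_in_imset //; exact: blowup_union_inj a.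
Qed.

Variable C : comNzRingType.
Variable x : V * 'I_(k./2) -> C.

Definition block_prod v := \prod_a x (v, a).

Lemma prod_blowup v : \prod_(p in blowup k v) x p = block_prod v.
Proof.
have -> : blowup k v = [set (v, a) | a in 'I_(k./2)].
  apply/setP => -[u a]; rewrite inE /=.
  by apply/eqP/imsetP => [->|[b _ [-> _]]]; first by exists a.
by rewrite big_imset //= => a b _ _ [].
Qed.

(** The factor [x (v, a)] completes the product over each edge, which then splits over the two
    disjoint blocks. *)
Lemma gpower_edge_sum v a :
  x (v, a) * (\sum_(E in [set E in gpower k G | (v, a) \in E])
     \prod_(p in E :\ (v, a)) x p) =
  block_prod v * \sum_(u | G v u) block_prod u.
Proof.
rewrite gpower_edges_at big_imset; last exact: blowup_union_inj a.
rewrite !mulr_sumr; apply: eq_bigr => u Gvu.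
rewrite -big_setD1 /=; last by rewrite !inE eqxx.
rewrite -!prod_blowup -bigU //=; first by apply: eq_bigl => p; rewrite !inE.
rewrite -setI_eq0; apply/eqP/setP => p; rewrite !inE.
by apply/negP => /andP[/eqP-> /eqP vu]; move: Gvu; rewrite inE vu irrG.
Qed.

End Gpower.

(** * Both Laplacians as one family, and criteria for bipartiteness *)

Definition signed_laplacian (R : realType) (I : finType) (k : nat) (e : R)
    (H : hypergraph I) : tensor R I k :=
  fun t => degree_tensor R H t + e * adjacency R H t.

Arguments signed_laplacian {R I} k e H _ : simpl never.

Lemma laplacianE (R : realType) (I : finType) (k : nat) (H : hypergraph I) :
  laplacian R k H = signed_laplacian k (-1) H.
Proof. by apply: boolp.funext => t; rewrite /signed_laplacian mulN1r. Qed.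

Lemma signless_laplacianE (R : realType) (I : finType) (k : nat)
    (H : hypergraph I) :
  signless_laplacian R k H = signed_laplacian k 1 H.
Proof. by apply: boolp.funext => t; rewrite /signed_laplacian mul1r. Qed.

(** The default of [set_maximum] is 0, so a nonzero value is attained. *)
Lemma set_maximum_in (R : realType) (A : classical_sets.set R) :
  set_maximum A != 0 -> A (set_maximum A).
Proof.
rewrite /set_maximum; case: classical_sets.xgetP => [y -> []//|].
by rewrite eqxx.
Qed.

(** By connectedness [p] takes only the values [p v0] and [- p v0]; these differ, so they form a
    2-colouring. *)
Lemma alternating_bipartite (F : numDomainType) (V : finType) (G : rel V)
    (p : V -> F) (v0 : V) : symmetric G -> graph_connected G ->
  (forall v, p v != 0) -> (forall v u, G v u -> p v = - p u) ->
  graph_bipartite G.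
Proof.
move=> symG connG p0 pG.
have pE : forall v, (p v == p v0) || (p v == - p v0).
  apply: (connected_closed symG connG (u := v0)); last by rewrite eqxx.
  move=> v u Gvu /orP[] /eqP pv.
    by rewrite -[p u]opprK -(pG _ _ Gvu) pv eqxx orbT.
  by rewrite -[p u]opprK -(pG _ _ Gvu) pv opprK eqxx.
have p_neq : (p v0 == - p v0) = false.
  by apply/negbTE; rewrite -addr_eq0 -mulr2n mulrn_eq0 negb_or p0.
exists (fun v => p v == p v0) => u v Guv.
rewrite (pG _ _ Guv); case/orP: (pE v) => /eqP ->.
  by rewrite eqxx [- p v0 == _]eq_sym p_neq.
by rewrite opprK eqxx [- p v0 == _]eq_sym p_neq.
Qed.

Lemma non_bipartite_vertex (V : finType) (G : rel V) :
  ~ graph_bipartite G -> exists v : V, True.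
Proof.
move=> nbip; apply: boolp.contrapT => V0; apply: nbip.
by exists xpredT => u; case: V0; exists u.
Qed.

(** In a connected graph an isolated vertex is the only vertex; there are then no edges and any
    colouring is proper. *)
Lemma non_bipartite_degree_gt0 (V : finType) (G : rel V) :
  symmetric G -> irreflexive G -> graph_connected G -> ~ graph_bipartite G ->
  forall v, (0 < graph_degree G v)%N.
Proof.
move=> symG irrG connG nbip v; rewrite lt0n; apply/eqP => /card0_eq d0.
have V1 : forall u, u == v.
  apply: (connected_closed symG connG (u := v)) => // a b Gab /eqP av.
  by have := d0 b; rewrite !inE -av Gab.
by apply: nbip; exists xpredT => a b; rewrite (eqP (V1 a)) (eqP (V1 b)) irrG.
Qed.

(** * Eigenvalues of the signed Laplacians of the generalized power *)

Section GpowerSpectrum.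
Variables (R : realType) (V : finType) (G : rel V).
Hypotheses (symG : symmetric G) (irrG : irreflexive G)
  (connG : graph_connected G) (deg_gt0 : forall v, (0 < graph_degree G v)%N).
Variables (k : nat) (k_gt0 : (0 < k)%N) (k_even : ~~ odd k).
Variables (q : R) (z : V -> R) (v0 : V).
Hypotheses (z_gt0 : forall v, 0 < z v)
  (zE : forall v, (q - (graph_degree G v)%:R) * z v = nbr_sum G z v).

Let T (e : R) : tensor R (V * 'I_(k./2))%type k :=
  signed_laplacian k e (gpower k G).

Let kE : k = k./2.*2. Proof. by rewrite even_halfK. Qed.

Let m_gt0 : (0 < k./2)%N. Proof. by rewrite -double_gt0 -kE. Qed.

Let a0 : 'I_(k./2) := Ordinal m_gt0.

Let zC_gt0 v : 0 < (z v)%:C. Proof. by rewrite ltcR. Qed.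

Let zCE v : (q%:C - (graph_degree G v)%:R) * (z v)%:C =
  nbr_sum G (fun u => (z u)%:C) v.
Proof.
by rewrite -(rmorph_nat (real_complex R)) -rmorphB -rmorphM zE rmorph_sum.
Qed.

Let deg_lt v : ((graph_degree G v)%:R < q%:C :> R[i]).
Proof.
rewrite -subr_gt0 -(pmulr_lgt0 _ (zC_gt0 v)) zCE.
have /card_gt0P[u Gvu] := deg_gt0 v; rewrite inE in Gvu.
rewrite /nbr_sum (bigD1 u) //= ltr_pwDl //.
by apply: sumr_ge0 => w _; exact: ltW.
Qed.

Lemma perron_gt0 : 0 < q.
Proof. by rewrite -ltcR; apply: le_lt_trans (deg_lt v0); exact: ler0n. Qed.

Lemma gpower_app e (x : {ffun V * 'I_(k./2) -> R[i]}) v a :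
  x (v, a) * tensor_app (T e) x (v, a) =
  (graph_degree G v)%:R * x (v, a) ^+ k +
  e%:C * (block_prod x v * nbr_sum G (block_prod x) v).
Proof.
have unifH := @gpower_uniform V k G irrG k_even.
have := @signed_laplacian_app R _ k.-1.
rewrite prednK // => /(_ _ _ unifH) ->.
rewrite mulrDr mulrCA -exprS prednK // (mulrCA _ e%:C).
by rewrite gpower_edge_sum // gpower_degree.
Qed.

Lemma gpower_eigen_eq e l x : eigenpair (T e) l x -> forall v a,
  (l - (graph_degree G v)%:R) * x (v, a) ^+ (k./2).*2 =
  e%:C * (block_prod x v * nbr_sum G (block_prod x) v).
Proof.
move=> [_ Tx] v a; have := gpower_app e x v a.
rewrite Tx ffunE mulrCA -exprS prednK // mulrBl -kE => ->.
by rewrite addrC addKr.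
Qed.

Lemma gpower_eigen_neq0 e l x : eigenpair (T e) l x ->
  exists v a, x (v, a) != 0.
Proof.
move=> [x0 _]; apply: boolp.contrapT => x_0; case/eqP: x0.
apply/ffunP => -[v a].
by rewrite ffunE; apply/eqP/negPn/negP => xva; apply: x_0; exists v, a.
Qed.

Lemma gpower_eigenvalue_le e l :
  `|e%:C| = 1 -> tensor_eigenvalue (T e) l -> `|l| <= q%:C.
Proof.
move=> ne [x xl]; have [v [a xva]] := gpower_eigen_neq0 xl.
exact: (power_eigenvalue_le symG zC_gt0 zCE m_gt0 ne (gpower_eigen_eq xl) xva).
Qed.

(* Scaling one entry of each block by c multiplies the block products by c and,
   as c ^+ k = 1, leaves the k-th powers of the entries unchanged. *)
Lemma gpower_perron_eigenvalue (e : R) (c : R[i]) :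
  c ^+ k = 1 -> e%:C * c ^+ 2 = 1 -> tensor_eigenvalue (T e) q%:C.
Proof.
move=> ck ec.
pose x := [ffun p : V * 'I_(k./2) =>
  (if p.2 == a0 then c else 1) * (k./2).-root (z p.1)%:C].
have xk v a : x (v, a) ^+ k = (z v)%:C ^+ 2.
  rewrite ffunE exprMn (fun_if (fun u => u ^+ k)) ck expr1n if_same mul1r /=.
  by rewrite [X in _ ^+ X]kE -muln2 exprM rootCK.
have yE v : block_prod x v = c * (z v)%:C.
  rewrite /block_prod; under eq_bigr do rewrite ffunE /=.
  rewrite big_split /= -big_mkcond big_pred1_eq prodr_const card_ord.
  by rewrite rootCK.
have xN0 p : x p != 0.
  case: p => v a; have : x (v, a) ^+ k != 0 by rewrite xk expf_neq0 // gt_eqF.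
  by rewrite expf_eq0 k_gt0.
exists x; split.
  by apply/eqP => /ffunP/(_ (v0, a0)); rewrite [RHS]ffunE; exact/eqP.
apply/ffunP => -[v a]; apply: (mulfI (xN0 (v, a))).
rewrite gpower_app [X in _ = _ * X]ffunE [RHS]mulrCA -exprS prednK // xk yE.
rewrite /nbr_sum; under eq_bigr do rewrite yE.
rewrite -mulr_sumr -/(nbr_sum G _ v) -zCE.
(* The two block products together contribute [c ^+ 2], which the hypothesis [ec] pairs with [e]. *)
transitivity ((graph_degree G v)%:R * (z v)%:C ^+ 2 + (e%:C * c ^+ 2) *
  ((z v)%:C * ((q%:C - (graph_degree G v)%:R) * (z v)%:C))); first by ring.
by rewrite ec; ring.
Qed.

Lemma gpower_extremal_bipartite l x : eigenpair (T (-1)) l x ->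
  `|l| = q%:C -> odd k./2 \/ (forall p, x p \is Num.real) ->
  graph_bipartite G.
Proof.
move=> xl nl; have [v1 [a1 x1]] := gpower_eigen_neq0 xl.
have ne : `|(-1 : R)%:C| = 1 :> R[i] by rewrite rmorphN1 normrN1.
have xE := gpower_eigen_eq xl.
have wgt0 := extremal_gt0 symG connG zC_gt0 zCE m_gt0 ne xE x1 deg_lt nl.
have edge := extremal_edge symG connG zC_gt0 zCE m_gt0 ne xE x1
  deg_lt deg_gt0 nl.
set y := block_prod x.
have {}wgt0 v : 0 < `|y v| by exact: wgt0.
have {}edge v u a : G v u ->
    x (v, a) ^+ (k./2).*2 * `|y u| = - (y v * y u * `|y v|).
  by move=> Gvu; rewrite (edge v u a Gvu) rmorphN1 mulN1r.
have yN0 v : y v != 0 by rewrite -normr_gt0.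
case=> [m_odd | x_real].
  apply: (alternating_bipartite (p := fun v => (y v / `|y v|) ^+ k./2)
    v0 symG connG) => [v|v u Gvu].
    by rewrite expf_neq0 // mulf_neq0 // invr_eq0 gt_eqF.
  (* Over the block the entries multiply to [y v ^+ k]; cancelling [y v ^+ k./2] leaves the
     alternating relation, with the sign kept because [k./2] is odd. *)
  have : \prod_(a < k./2) (x (v, a) ^+ (k./2).*2 * `|y u|) =
      \prod_(a < k./2) (- (y v * y u * `|y v|)).
    by apply: eq_bigr => a _; exact: edge.
  rewrite big_split /= prodrXl -/(block_prod x v) -/(y v).
  rewrite !prodr_const !card_ord.
  rewrite exprNn -signr_odd m_odd expr1 mulN1r.
  rewrite -addnn exprD !exprMn -!mulrA -mulrN.
  move/(mulfI (expf_neq0 _ (yN0 v))) => E.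
  rewrite !exprVn -mulNr.
  have wN0 w : `|y w| ^+ k./2 != 0 by rewrite expf_neq0 // normr_eq0.
  apply/eqP; rewrite eqr_div; [|exact: wN0|exact: wN0].
  by rewrite E mulNr.
have y_real v : y v \is Num.real by apply: rpred_prod => a _.
(* For real [x] the even power on the left of [edge] is nonnegative, so adjacent block products have
   opposite signs. *)
exists (fun v => 0 < y v) => v u Gvu.
have : y v * y u < 0.
  have : x (v, a0) ^+ (k./2).*2 * `|y u| >= 0.
    by rewrite mulr_ge0 // -muln2 exprM -realEsqr rpredX.
  rewrite (edge _ _ _ Gvu) oppr_ge0 (pmulr_lle0 _ (wgt0 v)) => yy.
  by rewrite lt_neqAle yy mulf_neq0.
case/real_ltgt0P: (y_real v) (yN0 v) => // yv _ /=.
  by rewrite pmulr_rlt0 // => /lt_gtF ->.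
by rewrite nmulr_rlt0 // => ->.
Qed.

End GpowerSpectrum.

Theorem theorem3p3 (R : realType) (V : finType) (G : rel V)
  (symG : symmetric G) (irrG : irreflexive G)
  (connG : graph_connected G) (nbipG : ~ graph_bipartite G)
  (k : nat) (k_ge4 : (4 <= k)%N) (k_even : ~~ odd k) :
  (spectral_radius (laplacian R k (gpower k G)) =
     spectral_radius (signless_laplacian R k (gpower k G))
   <-> (4 %| k)%N) /\
  ((4 %| k)%N ->
   lambda_max (laplacian R k (gpower k G)) <
     spectral_radius (laplacian R k (gpower k G))).
Proof.
rewrite laplacianE signless_laplacianE.
have [v0 _] := non_bipartite_vertex nbipG.
have deg_gt0 := non_bipartite_degree_gt0 symG irrG connG nbipG.
have k_gt0 : (0 < k)%N by apply: leq_trans k_ge4.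
have [q [z [z_gt0 zE]]] := perron_vector R symG connG v0.
have q_gt0 := perron_gt0 deg_gt0 v0 z_gt0 zE.
have ubq e l : `|e%:C| = 1 :> R[i] ->
    tensor_eigenvalue (signed_laplacian k e (gpower k G)) l -> `|l| <= q%:C.
  exact: (gpower_eigenvalue_le symG irrG k_gt0 k_even z_gt0 zE).
have radius e : `|e%:C| = 1 :> R[i] ->
    tensor_eigenvalue (signed_laplacian k e (gpower k G)) q%:C ->
    spectral_radius (signed_laplacian k e (gpower k G)) = q.
  move=> ne qe; apply: set_maximumE => /=.
    by exists q%:C; split=> //; rewrite ger0_norm ?ler0c ?ltW.
  by move=> r /= [l [/(ubq _ _ ne) lq rE]]; rewrite -lecR -rE.
have eigen := gpower_perron_eigenvalue symG irrG k_gt0 k_even v0 z_gt0 zE.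
have n1 : `|(1 : R)%:C| = 1 :> R[i] by rewrite rmorph1 normr1.
have nN1 : `|(-1 : R)%:C| = 1 :> R[i] by rewrite rmorphN1 normrN1.
have radiusQ : spectral_radius (signed_laplacian k 1 (gpower k G)) = q.
  by apply: radius => //; apply: (eigen 1 1); rewrite ?rmorph1 ?expr1n ?mulr1.
have extremal := gpower_extremal_bipartite symG irrG connG deg_gt0 k_gt0 k_even
  v0 z_gt0 zE.
have radiusL : (4 %| k)%N ->
    spectral_radius (signed_laplacian k (-1) (gpower k G)) = q.
  (* The imaginary unit satisfies both conditions on [c]: its [k]-th power is 1 as 4 divides [k],
     and its square is -1. *)
  move=> /dvdnP[j kj]; apply: radius => //; apply: (eigen (-1) 'i%C).
    by rewrite kj mulnC exprM (exprM _ 2 2) sqr_i sqrrN expr1n expr1n.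
  by rewrite sqr_i rmorphN1 mulrNN mulr1.
have m_even : odd k./2 = ~~ (4 %| k)%N.
  rewrite -[in RHS](even_halfK k_even) -muln2.
  by rewrite (@dvdn_pmul2r 2 2) // dvdn2 negbK.
rewrite radiusQ; split; first split=> [rL|]; last 1 first.
- move=> k4; rewrite radiusL //.
  (* The value 0, which may be the default, lies below [q > 0]; any other value is a genuine
     H-eigenvalue. *)
  set l := lambda_max _; have [->//|lN0] := eqVneq l 0.
  have [x [xl x_real]] :
      H_eigenvalue (signed_laplacian k (-1) (gpower k G)) l%:C.
    exact: set_maximum_in lN0.
  have := ubq _ _ nN1 (ex_intro _ x xl) => lq.
  rewrite lt_neqAle; apply/andP; split.
    apply/eqP => lE; apply: nbipG; apply: (extremal _ _ xl); last by right.
    by rewrite lE ger0_norm // ler0c ltW.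
  rewrite -lecR; apply: le_trans lq; apply: real_ler_norm.
  by rewrite complex_real.
- apply/negPn/negP => k4.
  (* A nonzero radius is attained, which provides an eigenvalue of modulus [q] while [k./2] is
     odd. *)
  have rN0 : spectral_radius (signed_laplacian k (-1 : R) (gpower k G)) != 0.
    by rewrite rL gt_eqF.
  have [l [[x xl] nl]] := set_maximum_in rN0.
  apply: nbipG; apply: (extremal _ _ xl); last by left; rewrite m_even.
  by rewrite nl -[set_maximum _]/(spectral_radius _) rL.
- exact: radiusL.
Qed.
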